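(* Let $u^0_h=u^0\in X_h\subset X$ be given, and let $\{u^n\}_{n\ge 0}\subset X$ and $\{u_h^n\}_{n\ge 0}\subset X_h$ be defined by the iterations \[ (u^{n+1},v)_X=\mathsf{B}(u^n)(v)\quad \forall v\in X,\qquad (u_h^{n+1},v_h)_X=\mathsf{B}(u_h^n)(v_h)\quad \forall v_h\in X_h . \] Assume that the discretization of $X$ is fine enough such that, with a constant $\eta_h\ge 0$, \[ \left|\mathsf{B}(u_h^n)(v)-(u_h^{n+1},v)_X\right|\le \eta_h\|v\|_X\qquad \forall v\in X,\ \forall n\ge 0 . \] Then \[ \|u^{n+1}-u_h^{n+1}\|_X\le \frac{\eta_h}{1-\alpha}\qquad\text{for all } n\in\mathbb{N}=\{0,1,2,\dots\}. \]
   Context: $X$ is a real Hilbert space with inner product $(\cdot,\cdot)_X$ and norm $\|\cdot\|_X$, $X'$ is its dual, and $X_h\subset X$ is a finite dimensional linear subspace. $\mathsf{F}:X\to X'$ is a possibly nonlinear operator such that, for constants $L>0$, $c>0$ and all $x,y,v\in X$, \[ |\mathsf{F}(x)(v)-\mathsf{F}(y)(v)|\le L\|x-y\|_X\|v\|_X,\qquad (\mathsf{F}(x)-\mathsf{F}(y))(x-y)\ge c\|x-y\|_X^2 . \] For $t=c/L^2$ the operator $\mathsf{B}$ is defined by $\mathsf{B}(u)(v):=(u,v)_X-t\,\mathsf{F}(u)(v)$ for $u,v\in X$, and $\alpha:=\sqrt{1-(c/L)^2}$, which is assumed to lie in $(0,1)$. *)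

(* Defs.v *)
From HB Require Import structures.
From mathcomp Require Import all_boot all_order all_algebra.
From mathcomp Require Import boolp classical_sets reals topology normedtype.

Set Implicit Arguments.
Unset Strict Implicit.
Unset Printing Implicit Defensive.

Import Order.TTheory GRing.Theory Num.Theory.
Import numFieldNormedType.Exports.

Local Open Scope ring_scope.

(* A real Hilbert space is a complete normed space [X] together with a positive
   definite symmetric bilinear form [ip : {dot X for idfun}] that induces the
   norm of [X]. *)
Definition induces_norm (R : realType) (X : completeNormedModType R)
    (ip : {dot X for idfun}) : Prop :=
  forall x : X, `|x| = Num.sqrt (ip x x).

Record dual (R : realType) (X : normedModType R) := Dual {
  dual_fun :> {linear X -> R^o};
  dual_continuous : continuous dual_fun
}.

Definition finite_dimensional (R : realType) (X : normedModType R)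
    (S : submodClosed X) : Prop :=
  exists (d : nat) (e : 'I_d -> X),
    (forall i, e i \in S) /\
    (forall x, x \in S -> exists a : 'I_d -> R, x = \sum_i a i *: e i).

Definition Lipschitz_operator (R : realType) (X : normedModType R)
    (F : X -> dual X) (L : R) : Prop :=
  forall x y v : X, `|F x v - F y v| <= L * `|x - y| * `|v|.

Definition strongly_monotone (R : realType) (X : normedModType R)
    (F : X -> dual X) (c : R) : Prop :=
  forall x y : X, F x (x - y) - F y (x - y) >= c * `|x - y| ^+ 2.

Definition step_size (R : realType) (c L : R) : R := c / L ^+ 2.

Definition contraction_factor (R : realType) (c L : R) : R :=
  Num.sqrt (1 - (c / L) ^+ 2).

Definition opB (R : realType) (X : completeNormedModType R)
    (ip : {dot X for idfun}) (F : X -> dual X) (c L : R) (u v : X) : R :=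
  ip u v - step_size c L * F u v.

(* Main.v *)
Require Import Defs.
From HB Require Import structures.
From mathcomp Require Import all_boot all_order all_algebra.
From mathcomp Require Import boolp classical_sets reals topology normedtype.
From mathcomp Require Import ring lra.

Set Implicit Arguments.
Unset Strict Implicit.
Unset Printing Implicit Defensive.

Import Order.TTheory GRing.Theory Num.Theory.
Import numFieldNormedType.Exports.

Local Open Scope ring_scope.

(** Write [e = u n - uh n], [w = uh n.+1] and [d = u n.+1 - w].  Testing the
    exact iteration against [d] gives
      [ip d d = (B(u n) d - B(uh n) d) + (B(uh n) d - ip w d)].
    The second bracket is the residual, at most [eta * `|d|].  The first one is
    at most [alpha * `|e| * `|d|], because [B] is Lipschitz with the contraction
    factor [alpha] ([opB_contraction]).  Hence [`|d| <= alpha * `|e| + eta];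
    as both iterations start at the same point, the errors stay below the fixed
    point [eta / (1 - alpha)] of [r |-> alpha * r + eta].

    For the contraction, put [l = F x - F y] and [t = c / L^2].  If a vector [g]
    represents [l] on [e = x - y] and on the test vector [v], and has norm at
    most [L * `|e|], then [B x v - B y v = ip (e - t *: g) v] and
      [`|e - t *: g|^2 = `|e|^2 - 2 t l(e) + t^2 `|g|^2
                      <= (1 - 2 t c + t^2 L^2) `|e|^2 = alpha^2 `|e|^2].
    Only two test vectors are involved, so [g] can be sought in their span,
    where orthogonalisation gives it explicitly ([representer_on_pair]). *)

Section InnerProduct.
Variables (R : realType) (X : lmodType R) (ip : {dot X for idfun}).
Implicit Types (x y z : X) (a : R).

Lemma ipC x y : ip x y = ip y x.
Proof. by rewrite hermC /= expr0 mul1r. Qed.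

Lemma ipDl x y z : ip (x + y) z = ip x z + ip y z.
Proof. exact: linearDl. Qed.

Lemma ipBl x y z : ip (x - y) z = ip x z - ip y z.
Proof. exact: linearBl. Qed.

Lemma ipZl a x y : ip (a *: x) y = a * ip x y.
Proof. exact: linearZl_LR. Qed.

Lemma ipDr x y z : ip x (y + z) = ip x y + ip x z.
Proof. by rewrite ipC ipDl !(ipC x). Qed.

Lemma ipBr x y z : ip x (y - z) = ip x y - ip x z.
Proof. by rewrite ipC ipBl !(ipC x). Qed.

Lemma ipZr a x y : ip x (a *: y) = a * ip x y.
Proof. by rewrite ipC ipZl ipC. Qed.

Lemma ip0l x : ip 0 x = 0.
Proof. by rewrite -(scale0r 0) ipZl mul0r. Qed.

Lemma ip0r x : ip x 0 = 0.
Proof. by rewrite ipC ip0l. Qed.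

Lemma ip_ge0 x : 0 <= ip x x.
Proof.
have [->|x0] := eqVneq x 0; first by rewrite ip0l.
exact/ltW/neq0_dnorm_gt0.
Qed.

Lemma ip_CauchySchwarz x y : ip x y ^+ 2 <= ip x x * ip y y.
Proof.
have [->|y0] := eqVneq y 0; first by rewrite !ip0r expr0n mulr0.
have yy : 0 < ip y y by exact: neq0_dnorm_gt0.
(* [ip y y *: x - ip x y *: y] is orthogonal to [y] *)
have := ip_ge0 (ip y y *: x - ip x y *: y).
rewrite !(ipBl, ipBr, ipZl, ipZr) (ipC y x).
set a := ip x x; set b := ip x y; set d := ip y y => h.
have : 0 <= d * (a * d - b ^+ 2) by lra.
by rewrite pmulr_rge0 // subr_ge0.
Qed.

End InnerProduct.

Section RealInnerProductSpace.
Variables (R : realType) (X : completeNormedModType R) (ip : {dot X for idfun}).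
Hypothesis hip : induces_norm ip.
Implicit Types (a : R) (x y v : X).

Lemma sqr_norm_ip x : `|x| ^+ 2 = ip x x.
Proof. by rewrite hip sqr_sqrtr // ip_ge0. Qed.

Lemma ip_le_norm x y : `|ip x y| <= `|x| * `|y|.
Proof.
rewrite -ler_sqr ?nnegrE ?mulr_ge0 // exprMn !sqr_norm_ip real_normK ?num_real //.
exact: ip_CauchySchwarz.
Qed.

Lemma sqr_norm_subZ a x y :
  `|x - a *: y| ^+ 2 = `|x| ^+ 2 - 2 * a * ip y x + a ^+ 2 * `|y| ^+ 2.
Proof.
by rewrite !sqr_norm_ip !(ipBl, ipBr, ipZl, ipZr) (ipC ip x y); ring.
Qed.

(** Replace [e], [v] by an orthogonal pair [e], [w] with the same span and add
    up the representers on the two lines.  Since [g] lies in that span,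
    [ip g g = l g], so the norm bound follows from that of [l] at [g]. *)
Lemma representer_on_pair (l : {linear X -> R^o}) (K : R) (e v : X) :
    0 <= K -> (forall x, `|l x| <= K * `|x|) ->
  exists g : X, [/\ ip g e = l e, ip g v = l v & `|g| <= K].
Proof.
move=> K0 lK.
have [a [w [ve we]]] : exists a w, v = a *: e + w /\ ip e w = 0.
  exists (ip v e / ip e e), (v - (ip v e / ip e e) *: e).
  split; first by rewrite addrC subrK.
  have [->|e0] := eqVneq e 0; first by rewrite ip0l.
  have ee : ip e e != 0 by rewrite gt_eqF // neq0_dnorm_gt0.
  by rewrite ipBr ipZr divfK // (ipC ip e) subrr.
(* valid also for [z = 0], since then the division by zero is multiplied by 0 *)
have proj z : l z / ip z z * ip z z = l z.
  have [->|z0] := eqVneq z 0; first by rewrite ip0l linear0 mulr0.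
  by rewrite divfK // gt_eqF // neq0_dnorm_gt0.
pose g := (l e / ip e e) *: e + (l w / ip w w) *: w.
have ge : ip g e = l e by rewrite ipDl !ipZl (ipC ip w) we mulr0 addr0 proj.
have gw : ip g w = l w by rewrite ipDl !ipZl we mulr0 add0r proj.
have gg : ip g g = l g.
  by rewrite {2}/g ipDr !ipZr ge gw [in RHS]/g linearD !linearZ.
exists g; split => //.
  by rewrite ve ipDr ipZr ge gw linearD linearZ.
have [->|g0] := eqVneq g 0; first by rewrite normr0.
have := le_trans (ler_norm _) (lK g).
by rewrite -gg -sqr_norm_ip expr2 ler_pM2r // normr_gt0.
Qed.

(** The step [c / L ^+ 2] minimises [t |-> 1 - 2 * t * c + t ^+ 2 * L ^+ 2],
    and the minimum is [1 - (c / L) ^+ 2]. *)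
Lemma opB_contraction (F : X -> dual X) (L c : R) (x y v : X) :
    0 < L -> 0 < c -> Lipschitz_operator F L -> strongly_monotone F c ->
    0 < contraction_factor c L ->
  `|opB ip F c L x v - opB ip F c L y v|
    <= contraction_factor c L * `|x - y| * `|v|.
Proof.
move=> L0 c0 hLip hmon alpha0.
pose l : {linear X -> R^o} := F x \- F y.
set e := x - y; set t := step_size c L.
have [g [ge gv gK]] : exists g : X,
    [/\ ip g e = l e, ip g v = l v & `|g| <= L * `|e|].
  by apply: representer_on_pair => [|z]; [rewrite mulr_ge0 // ltW|exact: hLip].
have -> : opB ip F c L x v - opB ip F c L y v = ip (e - t *: g) v.
  by rewrite ipBl ipZl gv /opB /e ipBl /l /= -/t; ring.
apply: (le_trans (ip_le_norm _ _)); rewrite ler_wpM2r //.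
rewrite -ler_sqr ?nnegrE ?mulr_ge0 ?(ltW alpha0) // exprMn.
rewrite [contraction_factor _ _ ^+ 2]sqr_sqrtr; last first.
  by move: alpha0; rewrite sqrtr_gt0 => /ltW.
have -> : `|e - t *: g| ^+ 2 = `|e| ^+ 2 - 2 * t * l e + t ^+ 2 * `|g| ^+ 2.
  by rewrite sqr_norm_subZ ge.
have t0 : 0 <= t by rewrite divr_ge0 ?exprn_ge0 ?(ltW L0) ?(ltW c0).
have mono : 2 * t * (c * `|e| ^+ 2) <= 2 * t * l e.
  by apply: ler_wpM2l; [exact: mulr_ge0|exact: hmon].
have gK2 : t ^+ 2 * `|g| ^+ 2 <= t ^+ 2 * (L * `|e|) ^+ 2.
  by rewrite ler_wpM2l ?exprn_ge0 // ler_sqr ?nnegrE ?mulr_ge0 // ltW.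
have -> : (1 - (c / L) ^+ 2) * `|e| ^+ 2 =
    `|e| ^+ 2 - 2 * t * (c * `|e| ^+ 2) + t ^+ 2 * (L * `|e|) ^+ 2.
  by rewrite /t /step_size; field; rewrite gt_eqF.
by rewrite lerD // lerB.
Qed.

End RealInnerProductSpace.

Theorem theorem2p1 (R : realType) (X : completeNormedModType R)
    (ip : {dot X for idfun}) (hip : induces_norm ip)
    (Xh : submodClosed X) (hXh : finite_dimensional Xh)
    (F : X -> dual X) (L c : R) (hL : 0 < L) (hc : 0 < c)
    (hLip : Lipschitz_operator F L) (hmon : strongly_monotone F c)
    (halpha : 0 < contraction_factor c L < 1)
    (u0 : X) (hu0 : u0 \in Xh)
    (u uh : nat -> X) (hu_init : u 0%N = u0) (huh_init : uh 0%N = u0)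
    (huh_in : forall n, uh n \in Xh)
    (hu_iter : forall n (v : X), ip (u n.+1) v = opB ip F c L (u n) v)
    (huh_iter : forall n (vh : X), vh \in Xh ->
      ip (uh n.+1) vh = opB ip F c L (uh n) vh)
    (eta : R) (heta : 0 <= eta)
    (hres : forall n (v : X),
      `|opB ip F c L (uh n) v - ip (uh n.+1) v| <= eta * `|v|) :
  forall n, `|u n.+1 - uh n.+1| <= eta / (1 - contraction_factor c L).
Proof.
case/andP: halpha => alpha0 alpha1.
set alpha := contraction_factor c L.
have beta0 : 0 < 1 - alpha by rewrite subr_gt0.
have step n : `|u n.+1 - uh n.+1| <= alpha * `|u n - uh n| + eta.
  set d := u n.+1 - uh n.+1.
  have [->|d0] := eqVneq d 0.
    by rewrite normr0 addr_ge0 // mulr_ge0 // ltW.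
  rewrite -(@ler_pM2r _ `|d|) ?normr_gt0 // -expr2 (sqr_norm_ip hip).
  have -> : ip d d = (opB ip F c L (u n) d - opB ip F c L (uh n) d)
                     + (opB ip F c L (uh n) d - ip (uh n.+1) d).
    by rewrite {1}/d ipBl hu_iter; ring.
  apply: (le_trans (ler_norm _)); apply: (le_trans (ler_normD _ _)).
  by rewrite mulrDl lerD //; exact: opB_contraction.
suff bound n : `|u n - uh n| <= eta / (1 - alpha) by move=> n; exact: bound.
elim: n => [|n IH]; first by rewrite hu_init huh_init subrr normr0 divr_ge0 // ltW.
apply: (le_trans (step n)).
have -> : eta / (1 - alpha) = alpha * (eta / (1 - alpha)) + eta.
  by field; rewrite gt_eqF.
by rewrite lerD2r ler_wpM2l // ltW.
Qed.
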